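(* Let $\pi$ be a set of primes. Let $G$ be a finite group that has a unique minimal normal subgroup $V$, and suppose that $V$ is abelian and $V\not\leq Z(G)$. Suppose also that $L=G/V$ is a nonabelian simple group. Let $H$ be a $\pi$-submaximal subgroup of $G$, and let $G^*$ be a finite group of minimal order among the finite groups that contain $G$ as a subnormal subgroup and that have a $\pi$-maximal subgroup $K$ with $H=K\cap G$. Then $G$ is normal in $G^*$ and $C_{G^*}(G)=1$.
   Context: All groups are finite. For a set $\pi$ of primes, a $\pi$-group is a finite group all of whose prime divisors of the order belong to $\pi$. A $\pi$-maximal subgroup of a group $X$ is a subgroup of $X$ that is maximal by inclusion among the subgroups of $X$ that are $\pi$-groups. A subgroup $H$ of a group $G$ is $\pi$-submaximal if there exist an embedding of $G$ as a subnormal subgroup into some finite group $G^*$ and a $\pi$-maximal subgroup $K$ of $G^*$ such that $H=K\cap G$ (with $G$ identified with its image in $G^*$). $Z(G)$ denotes the center of $G$ and $C_{G^*}(G)$ the centralizer of $G$ in $G^*$. *)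

(* Defs.v *)
From mathcomp Require Import all_boot all_fingroup all_solvable.

Set Implicit Arguments.
Unset Strict Implicit.
Unset Printing Implicit Defensive.

Local Open Scope group_scope.

Definition pi_maximal (pi : nat_pred) (gT : finGroupType)
    (X K : {group gT}) : bool :=
  [max K of M | pi.-group M & M \subset X].

(* [minnormal V G] only says that V is minimal among the nontrivial groups
   normalized by G; it does not imply that V is contained in G. *)
Definition minimal_normal (gT : finGroupType) (G V : {group gT}) : bool :=
  (V \subset G) && minnormal V G.

Definition unique_minimal_normal (gT : finGroupType) (G V : {group gT}) : Prop :=
  minimal_normal G V /\
  forall W : {group gT}, minimal_normal G W -> W :=: V.

(* The morphism f embeds G as a subnormal subgroup of Gs, and H = K :&: G for
   some pi-maximal subgroup K of Gs, G being identified with its image f @* G.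
   H \subset G is required because f @* H only depends on G :&: H. *)
Definition submax_embedding (pi : nat_pred) (gT : finGroupType)
    (G H : {group gT}) (rT : finGroupType) (Gs : {group rT})
    (f : {morphism G >-> rT}) : Prop :=
  [/\ H \subset G, 'injm f, f @* G <|<| Gs
    & exists2 K : {group rT}, pi_maximal pi Gs K & f @* H = K :&: f @* G].

Definition pi_submaximal (pi : nat_pred) (gT : finGroupType)
    (G H : {group gT}) : Prop :=
  exists (rT : finGroupType) (Gs : {group rT}) (f : {morphism G >-> rT}),
    submax_embedding pi H Gs f.

(* Main.v *)
Require Import Defs.
From mathcomp Require Import all_boot all_algebra all_fingroup all_solvable.
From mathcomp Require Import all_field all_character.

(* The hypotheses make G perfect, with 1, V and G as its only normal subgroups.
   The key point is that a conjugate B of the subnormal subgroup G in Gs either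
   equals G or centralizes it.  Modulo R = F(Gs), which contains V, G becomes a
   simple subnormal subgroup, so either G <= B R or [G, B] <= R.  Moreover a
   perfect subgroup of B R lies in B; this gives G = B in the first case, and in
   the second that G and B normalize each other, so [G, B] <= G :&: B.  If this
   intersection were V, then B would act on V by G-endomorphisms; these form a
   finite division ring by Schur's lemma, hence a field by Wedderburn's theorem,
   and the perfect group B would centralize V.

   Next let N = N_Gs(G), C = C_Gs(G), and let K1 be a pi-maximal subgroup of N/C
   containing the image of N_K(G).  The preimage P of K1 in G is a pi-group
   normalized by N_K(G); since its distinct K-conjugates commute, P lies in
   O_pi(<P^K>), so that P <= K.  Thus N/C also realizes H as a pi-submaximal
   subgroup of G, and minimality of Gs forces N = Gs and C = 1. *)

Set Implicit Arguments.
Unset Strict Implicit.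
Unset Printing Implicit Defensive.

Local Open Scope group_scope.

(** * Commuting endomorphisms of irreducible modules *)

(** The matrices commuting with [rG] form the algebra [C]. By Schur's lemma it has no zero divisors;
    being finite, it is commutative by Wedderburn's theorem. *)
Lemma centgmx_comm (F : finFieldType) (gT : finGroupType) (G : {group gT}) n
    (rG : mx_representation F G n) (A B : 'M[F]_n) :
  mx_irreducible rG -> centgmx rG A -> centgmx rG B -> (A *m B = B *m A)%R.
Proof.
case: n => [|n] in rG A B *; first by rewrite (flatmx0 A) (flatmx0 B).
move=> irrG cA cB.
pose U := <<[seq (rG x : 'M[F]_n.+1) | x in G]>>%VS.
pose C : {aspace 'M[F]_n.+1} := 'C(U)%AS.
pose R : finUnitRingType := finvect_type (subvs_of C).
have inC M : centgmx rG M = (M \in C).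
  apply/centgmxP/centvP => [cM | cM x Gx].
    suffices /subvP sUM : (U <= 'C[M])%VS.
      by move=> u /sUM/cent1vP.
    by apply/span_subvP=> _ /imageP[x Gx ->]; apply/cent1vP; rewrite -[LHS]cM.
  by apply: cM; apply: memv_span; apply: image_f.
have domR : GRing.integral_domain_axiom R.
  move=> x y xy0; have [//|nzx] := eqVneq; apply/eqP.
  have Ux: vsval x \in unitmx.
    by apply: (mx_Schur irrG); rewrite ?inC ?subvsP.
  apply: val_inj; rewrite /= -(mulKmx Ux (vsval y)).
  have -> : (vsval x *m vsval y)%R = 0%R.
    by have := congr1 (@vsval _ _ C) xy0.
  by rewrite mulmx0.
rewrite !inC in cA cB.
by have := congr1 (@vsval _ _ C) (finDomain_mulrC domR (Subvs cA) (Subvs cB)).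
Qed.

(** [V] is an irreducible module for [G] over a prime field. Since [[~: G, B]] acts trivially on it,
    [B] acts by [G]-endomorphisms, and these commute. *)
Lemma minnormal_cent_der1 (gT : finGroupType) (V G B : {group gT}) :
    abelian V -> minnormal V G -> B \subset 'N(V) ->
    [~: G, B] \subset 'C(V) -> [~: B, B] \subset 'C(V).
Proof.
move=> abV minV nVB cGB.
have [nVG ntV /is_abelemP[p p_pr abelV]] :=
  minnormal_solvable minV (subxx V) (abelian_sol abV).
have nVX : G <*> B \subset 'N(V) by rewrite join_subG nVG.
pose rX := abelem_repr abelV ntV nVX.
have [sGX sBX] := joing_subP (subxx (G <*> B)).
have irrG : mx_irreducible (abelem_repr abelV ntV nVG).
  exact/abelem_mx_irrP.
(* [G] and [B] are represented together, in one basis of [V]. As the kernel of [rX] is the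
   centralizer of [V], commutators can be tested on matrices. *)
have comm_rX x y : x \in G <*> B -> y \in G <*> B ->
  ([~ x, y] \in 'C(V)) = (rX x *m rX y == rX y *m rX x)%R.
  move=> Xx Xy; have Xyx := groupM Xy Xx; have Xc := groupR Xx Xy.
  rewrite -!repr_mxM // (commgC x y) (repr_mxM rX Xyx Xc).
  have -> : ([~ x, y] \in 'C(V)) = ([~ x, y] \in rker rX).
    by rewrite rker_abelem in_setI Xc.
  apply/idP/eqP => [/rkerP[_ ->] | eqyx]; first by rewrite mulmx1.
  apply/rkerP; split=> //.
  rewrite -(mulKmx (repr_mx_unit rX Xyx) (rX [~ x, y])) eqyx.
  by rewrite mulVmx ?repr_mx_unit // mul1mx.
have cent x : x \in B -> centgmx (abelem_repr abelV ntV nVG) (rX x).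
  move=> Bx; apply/centgmxP => y Gy.
  have -> : abelem_repr abelV ntV nVG y = rX y.
    by apply/row_matrixP=> i; apply: rVabelem_inj;
       rewrite !rowE !rVabelemJ // (subsetP sGX).
  apply/esym/eqP; rewrite -comm_rX ?(subsetP sGX _ Gy) ?(subsetP sBX _ Bx) //.
  by rewrite (subsetP cGB) ?mem_commg.
rewrite gen_subG; apply/subsetP=> _ /imset2P[x y Bx By ->].
rewrite comm_rX ?(subsetP sBX) //; apply/eqP.
exact: centgmx_comm irrG (cent x Bx) (cent y By).
Qed.

(** * Perfect and simple groups along subnormal series *)

Lemma subnormal_up_ind (gT : finGroupType) (H : {group gT})
    (P : {group gT} -> Prop) :
    P H -> (forall K L : {group gT}, H <|<| K -> K <| L -> P K -> P L) ->
  forall G : {group gT}, H <|<| G -> P G.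
Proof.
move=> PH IH _ /subnormalP[s Hs <-].
elim/last_ind: s Hs => [|s L IHs]; first by [].
rewrite rcons_path last_rcons => /andP[Hs nsL].
by apply: IH _ nsL (IHs Hs); apply/subnormalP; exists s.
Qed.

(** Fitting subgroups increase along a subnormal series: each is characteristic in its group, hence
    nilpotent and normal in the next. *)
Lemma subnormal_sub_Fitting (gT : finGroupType) (H G : {group gT}) :
  H <|<| G -> nilpotent H -> H \subset 'F(G).
Proof.
move=> snHG nilH; elim/subnormal_up_ind: G / snHG => [|K L _ nsKL sHF].
  exact: Fitting_max.
apply: subset_trans sHF (Fitting_max _ (Fitting_nil K)).
exact: gFnormal_trans.
Qed.

Lemma perfect_sol_trivg (gT : finGroupType) (G : {group gT}) :
  G^`(1) = G -> solvable G -> G :=: 1.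
Proof.
move=> perfG solG; apply/eqP/negPn/negP => ntG.
by have := sol_der1_proper solG (subxx G) ntG; rewrite perfG properxx.
Qed.

(** Each factor of a subnormal series from [G] to [X] is an image of a subgroup of the solvable
    group [R]. The perfect group [B] maps trivially to it, and so descends the series to [G]. *)
Lemma perfect_sub_subnormal (gT : finGroupType) (R G X B : {group gT}) :
    solvable R -> X \subset 'N(R) -> G <|<| X -> X \subset G * R ->
    B^`(1) = B -> B \subset X -> B \subset G.
Proof.
move=> solR nRX snGX; elim/subnormal_up_ind: X / snGX nRX => // K L snGK.
move=> /andP[sKL nKL] IH nRL sLGR perfB sBL.
apply: IH => //; try exact: subset_trans sKL _.
have nKB := subset_trans sBL nKL.
rewrite -quotient_sub1 // [B / K]perfect_sol_trivg //.
  by rewrite -quotient_der ?perfB.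
(* Dedekind's law, applied to [L \subset K * R]. *)
have sLKR : L \subset K * (R :&: L).
  rewrite group_modl // subsetI subxx andbT.
  by rewrite (subset_trans sLGR) ?mulSg ?subnormal_sub.
have: B / K \subset (R :&: L) / K.
  by rewrite -(quotientMidl K (R :&: L)) quotientS // (subset_trans sBL).
by move/solvableS; apply; rewrite quotient_sol // (solvableS _ solR) ?subsetIl.
Qed.

(** By induction [K :&: M] centralizes [A], and it contains [[~: K, A]]. Hence [[~: K, A, A] = 1],
    and the three subgroup lemma shows that [K] centralizes [[~: A, A] = A]. *)
Lemma perfect_subnormal_cent (gT : finGroupType) (A K X : {group gT}) :
    A^`(1) = A -> A <|<| X -> K <| X -> A :&: K = 1 -> K \subset 'C(A).
Proof.
move=> perfA snAX; elim/subnormal_up_ind: X / snAX K => [K|M L snAM].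
  by move=> /andP[sKA _]; rewrite (setIidPr sKA) => ->; apply: sub1G.
move=> /andP[sML nML] IH K /andP[sKL nKL] tiAK.
have sAM := subnormal_sub snAM.
have cKM : K :&: M \subset 'C(A).
  apply: IH; last by apply/trivgP; rewrite -tiAK setIS ?subsetIl.
  by rewrite /normal subsetIr normsI ?normG // (subset_trans sML).
have sKAM : [~: K, A] \subset K :&: M.
  rewrite subsetI commg_subl (subset_trans (subset_trans sAM sML)) //=.
  by rewrite (subset_trans (commgS K sAM)) // commg_subr (subset_trans sKL).
have KAA : [~: K, A, A] = 1 by apply/commG1P; apply: subset_trans sKAM _.
have AKA : [~: A, K, A] = 1 by rewrite (commGC A K).
have := three_subgroup AKA KAA.
by rewrite -derg1 perfA commGC => /commG1P.
Qed.

(** At a step [K <| L] of a series from [S], simplicity makes [A :&: K] equal to [1], so that [K]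
    centralizes [A], or to [A], so that induction applies inside [K]. *)
Lemma simple_subnormal_sub_or_cent (gT : finGroupType) (A S X : {group gT}) :
    simple A -> A^`(1) = A -> A <|<| X -> S <|<| X ->
  A \subset S \/ S \subset 'C(A).
Proof.
move=> simA perfA snAX snSX.
elim/subnormal_up_ind: X / snSX snAX => [/subnormal_sub|]; first by left.
move=> K L snSK nsKL IH snAL; have [sKL nKL] := andP nsKL.
have sAL := subnormal_sub snAL; have sSK := subnormal_sub snSK.
have nsAK : A :&: K <| A.
  by rewrite /normal subsetIl normsI ?normG // (subset_trans sAL).
have [_ /(_ _ nsAK)[tiAK | /setIidPl sAK]] := simpleP _ simA.
  right; apply: subset_trans sSK _.
  exact: perfect_subnormal_cent snAL nsKL tiAK.
apply: IH; rewrite -(setIidPl sAK); exact: setI_subnormal sKL snAL.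
Qed.

(** * Conjugates of the subnormal subgroup [G] *)

Lemma subnormal_conj (gT : finGroupType) (G X : {group gT}) x :
  G <|<| X -> x \in X -> G :^ x <|<| X.
Proof.
move=> snGX Xx; have := morphim_subnormal (conjgm X x) snGX.
by rewrite !morphim_conj setIid (setIidPr (subnormal_sub snGX)) (conjGid Xx).
Qed.

Lemma conj_eq_or_cent (gT : finGroupType) (X G V : {group gT}) g :
    G <|<| X -> G^`(1) = G -> abelian V ->
    (forall N : {group gT}, N <| G -> [\/ N :=: 1, N :=: V | N :=: G]) ->
    V :!=: 1 -> V <| G -> ~~ (G \subset 'C(V)) -> g \in X ->
  G :^ g = G \/ G :^ g \subset 'C(G).
Proof.
move=> snGX perfG abV nsubG ntV nsVG ncVG Xg.
have sGX := subnormal_sub snGX; have [sVG nVG] := andP nsVG.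
have nsolG : ~~ solvable G.
  apply/negP=> /(perfect_sol_trivg perfG) G1.
  by rewrite G1 sub1G in ncVG.
have neqVG : V :!=: G by apply: contraNneq nsolG => <-; apply: abelian_sol.
have minV : minnormal V G.
  apply/mingroupP; split=> [|M /andP[ntM nMG] sMV]; first by rewrite ntV.
  have nsMG : M <| G by rewrite /normal nMG (subset_trans sMV).
  have [M1 | // | MG] := nsubG _ nsMG.
    by rewrite M1 eqxx in ntM.
  by case/eqP: neqVG; apply/eqP; rewrite eqEsubset sVG -MG.
pose R := 'F(X)%G.
have solR : solvable R by apply: nilpotent_sol (Fitting_nil X).
have nRX : X \subset 'N(R) by apply: gFnorm.
have sRX : R \subset X by apply: gFsub.
have sVR : V \subset R.
  apply: subnormal_sub_Fitting (abelian_nil abV).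
  exact: subnormal_trans (normal_subnormal nsVG) snGX.
have GR : R :&: G = V.
  have nsRG : R :&: G <| G.
    by rewrite /normal subsetIr normsI ?normG // (subset_trans sGX).
  have [RG1 | // | RG] := nsubG _ nsRG.
    by case/eqP: ntV; apply/trivgP; rewrite -RG1 subsetI sVR.
  by case/negP: nsolG; rewrite -RG (solvableS _ solR) ?subsetIl.
(* By the second isomorphism theorem [G / R] is isomorphic to [G / V], whose normal subgroups are
   read off from [nsubG]. *)
have simGR : simple (G / R).
  have nRG := subset_trans sGX nRX.
  rewrite -(isog_simple (second_isog nRG)) GR; apply/simpleP; split.
    rewrite -subG1 quotient_sub1 //; apply: contra neqVG => sGV.
    by rewrite eqEsubset sVG.
  move=> N /(inv_quotientN nsVG)[M -> _ /nsubG[-> | -> | ->]].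
  - by left; apply: quotient1.
  - by left; apply: trivg_quotient.
  - by right.
have sBX x : x \in X -> G :^ x \subset X by move=> Xx; rewrite conj_subG.
have snB x : x \in X -> G :^ x <|<| X by apply: subnormal_conj.
have perfB x : (G :^ x)^`(1) = G :^ x by rewrite derJ perfG.
(* The perfect group [G :^ x] descends from [(G :^ y) * R] to [G :^ y]; equal orders give
   equality. *)
have absorb x y : x \in X -> y \in X -> G :^ x \subset (G :^ y) * R ->
    G :^ x = G :^ y.
  move=> Xx Xy sxyR; apply/eqP; rewrite eqEcard !cardJg leqnn andbT.
  have nRy : G :^ y \subset 'N(R) by apply: subset_trans (sBX y Xy) nRX.
  have sYX : (G :^ y) <*> R \subset X by rewrite join_subG sBX.
  have snY : G :^ y <|<| (G :^ y) <*> R.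
    have := setI_subnormal sYX (snB y Xy).
    by rewrite (setIidPl (joing_subl _ _)).
  apply: (perfect_sub_subnormal solR _ snY) => //.
  - exact: subset_trans sYX nRX.
  - by rewrite /= norm_joinEl.
  - exact: perfB.
  - by rewrite /= norm_joinEl.
(* For [b] in [G :^ x] and [z] in [G :^ y], [z ^ b = z * [~ z, b]] lies in [(G :^ y) * R], so
   [absorb] identifies [G :^ y] with its conjugate by [b]. *)
have norm x y : x \in X -> y \in X -> [~: G :^ x, G :^ y] \subset R ->
    G :^ x \subset 'N(G :^ y).
  move=> Xx Xy; rewrite commGC => sR; apply/subsetP=> b Gb.
  have Xb : b \in X := subsetP (sBX x Xx) b Gb.
  apply/normP; rewrite -conjsgM; apply: absorb; rewrite ?groupM //.
  rewrite conjsgM; apply/subsetP=> _ /imsetP[z Gz ->].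
  by rewrite conjg_mulR mem_mulg // (subsetP sR) // mem_commg.
have perfGR : (G / R)^`(1) = G / R.
  by rewrite -quotient_der ?perfG // (subset_trans sGX).
have [|cGR] := simple_subnormal_sub_or_cent simGR perfGR
    (quotient_subnormal _ snGX) (quotient_subnormal _ (snB g Xg)).
  rewrite (quotientSK _ (subset_trans sGX nRX)).
  move=> sGB; left; rewrite -(absorb 1 g) ?conjsg1 //.
  by rewrite (normC (subset_trans (sBX g Xg) nRX)).
have sR : [~: G, G :^ g] \subset R.
  rewrite commGC -quotient_cents2 ?(subset_trans sGX) //.
  exact: subset_trans (sBX g Xg) nRX.
have nBG : G \subset 'N(G :^ g) by rewrite -{1}(conjsg1 G) norm ?conjsg1.
have nGB : G :^ g \subset 'N(G) by rewrite -{2}(conjsg1 G) norm ?conjsg1 // commGC.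
have sI : [~: G, G :^ g] \subset G :&: G :^ g.
  by rewrite subsetI commg_subl nGB commg_subr.
have nsIG : G :&: G :^ g <| G by rewrite /normal subsetIl normsI ?normG.
have nsIB : G :&: G :^ g <| G :^ g by rewrite /normal subsetIr normsI ?normG.
have [I1 | IV | IG] := nsubG _ nsIG.
- by right; rewrite centsC; apply/commG1P/trivgP; rewrite -I1.
(* Here [V] is normal in [G :^ g] too, so [V :^ g^-1] is normal in [G] and equals [V] by its order.
   Thus, once [G :^ g] centralizes [V], so does [G]. *)
- have VgV : V :^ g^-1 = V.
    have nsVgG : V :^ g^-1 <| G.
      by rewrite -[X in _ <| X](conjsgK g) normalJ -IV.
    apply/eqP; rewrite eqEcard cardJg leqnn andbT.
    have [V1 | -> // | VG] := nsubG _ nsVgG.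
      by rewrite V1 sub1G.
    by case/eqP: neqVG; apply/eqP; rewrite eqEcard sVG -VG cardJg /=.
  have cGV : [~: G :^ g, G :^ g] \subset 'C(V).
    apply: (minnormal_cent_der1 abV minV).
      by rewrite -IV normal_norm.
    by rewrite (subset_trans sI) ?IV.
  case/negP: ncVG; rewrite -VgV centJ -(conjsgK g G) conjSg.
  by rewrite -perfB.
- by left; apply/esym/eqP; rewrite eqEcard cardJg leqnn -{1}IG subsetIr.
Qed.

(** * Maximal pi-subgroups and the passage to the normalizer modulo the centralizer *)

Lemma pi_maximal_sub (pi : nat_pred) (gT : finGroupType) (X K M : {group gT}) :
  pi_maximal pi X K -> M \subset X -> pi.-group M -> K \subset M -> M \subset K.
Proof.
by move=> /maxgroupP[_ maxK] sMX piM sKM; rewrite (maxK M) ?piM.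
Qed.

Lemma pi_maximal_absorb (pi : nat_pred) (gT : finGroupType)
    (X K G P : {group gT}) :
    pi_maximal pi X K -> G \subset X -> P \subset G -> pi.-group P ->
    'N_K(G) \subset 'N(P) ->
    (forall g, g \in X -> G :^ g = G \/ G :^ g \subset 'C(G)) ->
  P \subset K.
Proof.
move=> maxK sGX sPG piP nPK conjG.
have /andP[piK sKX] := maxgroupp maxK.
have sPX := subset_trans sPG sGX.
(* Either [k] normalizes [G], hence [P], or [P :^ k] centralizes [P]. *)
have nsPk k : k \in K -> P :^ k \subset 'N(P).
  move=> Kk; have [Gk | cGk] := conjG k (subsetP sKX k Kk).
    suffices /normP-> : k \in 'N(P) by apply: normG.
    by apply: (subsetP nPK); rewrite inE Kk; apply/normP.
  apply: cents_norm; apply: subset_trans (centS sPG).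
  by apply: subset_trans cGk; rewrite conjSg.
pose S := <<class_support P K>>%G.
have sSX : S \subset X.
  rewrite gen_subG class_supportEr; apply/bigcupsP=> k Kk.
  by rewrite conj_subG // (subsetP sKX).
have nSK : K \subset 'N(S) by rewrite norms_gen ?class_support_norm.
have sPS : P \subset S by rewrite sub_gen ?sub_class_support.
have nsPS : P <| S.
  rewrite /normal sPS gen_subG class_supportEr; apply/bigcupsP=> k Kk.
  exact: nsPk.
(* [K] normalizes ['O_pi(S)], so their product is a pi-group, and maximality of [K] applies. *)
have sKO : 'O_pi(S) <*> K \subset K.
  apply: pi_maximal_sub maxK _ _ (joing_subr _ _).
    by rewrite join_subG sKX (subset_trans (pcore_sub _ _)).
  rewrite /= norm_joinEr ?pgroupM ?pcore_pgroup //.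
  exact: gFnorm_trans.
apply: subset_trans sKO; apply: subset_trans (joing_subl _ _).
exact: pcore_max.
Qed.

Lemma pi_maximal_exists (pi : nat_pred) (gT : finGroupType) (X Q : {group gT}) :
    Q \subset X -> pi.-group Q ->
  exists2 K : {group gT}, pi_maximal pi X K & Q \subset K.
Proof.
move=> sQX piQ.
have [|K maxK sQK] := @maxgroup_exists _
    (fun M : {group gT} => pi.-group M && (M \subset X)) Q.
  by rewrite piQ.
by exists K.
Qed.

Lemma submax_embedding_aut (pi : nat_pred) (gT : finGroupType)
    (X K G : {group gT}) :
    pi_maximal pi X K -> G \subset X -> 'C_X(G) :&: G = 1 ->
    (forall g, g \in X -> G :^ g = G \/ G :^ g \subset 'C(G)) ->
  exists f : {morphism G >-> coset_of 'C_X(G)},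
    submax_embedding pi (K :&: G) ('N_X(G) / 'C_X(G)) f.
Proof.
move=> maxK sGX tiCG conjG.
have /andP[piK sKX] := maxgroupp maxK.
pose D := 'N_X(G)%G; pose C := 'C_X(G)%G.
have nsCD : C <| D by apply: subcent_normal.
have nCD := normal_norm nsCD.
have sGD : G \subset D by rewrite subsetI sGX normG.
have nCG : G \subset 'N(C) := subset_trans sGD nCD.
have nsGD : G <| D by rewrite /normal sGD subsetIr.
(* Taking [K1] above the image of ['N_K(G)] serves twice: ['N_K(G)] will normalize [P], and
   [K :&: G] will lie in [P]. *)
have [K1 maxK1 sKK1] : exists2 K1 : {group coset_of C},
    pi_maximal pi (D / C) K1 & 'N_K(G) / C \subset K1.
  apply: pi_maximal_exists; first by rewrite quotientS ?setSI.
  by rewrite quotient_pgroup // (pgroupS _ piK) ?subsetIl.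
have /andP[piK1 _] := maxgroupp maxK1.
pose P := (G :&: coset C @*^-1 K1)%G.
have PC : P / C = K1 :&: G / C by rewrite [RHS]setIC; apply: morphim_setIpre.
have piP : pi.-group P.
  have nCP : P \subset 'N(C) := subset_trans (subsetIl _ _) nCG.
  have tiCP : C :&: P = 1.
    by apply/trivgP; rewrite -tiCG setIS ?subsetIl.
  rewrite /pgroup (card_isog (quotient_isog nCP tiCP)).
  by apply: pgroupS piK1; move: (subsetIl K1 (G / C)); rewrite -PC.
have sQ : 'N_K(G) \subset coset C @*^-1 K1.
  by rewrite -sub_quotient_pre // (subset_trans _ nCD) ?setSI.
have nPK : 'N_K(G) \subset 'N(P).
  by apply: normsI; [apply: subsetIr | apply: subset_trans sQ (normG _)].
have sPK : P \subset K.
  exact: pi_maximal_absorb maxK sGX (subsetIl _ _) piP nPK conjG.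
have defP : P :=: K :&: G.
  apply/eqP; rewrite eqEsubset; apply/andP; split.
    by rewrite subsetI sPK subsetIl.
  rewrite subsetI subsetIr /=.
  by apply: subset_trans sQ; rewrite setIS ?normG.
exists (restrm_morphism nCG (coset_morphism C)).
split.
- exact: subsetIr.
- by rewrite ker_restrm ker_coset setIC tiCG.
- rewrite morphim_restrm setIid; exact/normal_subnormal/quotient_normal.
- exists K1 => //; rewrite !morphim_restrm setIid (setIidPr (subsetIr K G)) /=.
  by rewrite -defP.
Qed.

(** * Normal subgroups of [G], and the minimal embedding *)

(** A nontrivial [N] contains a minimal normal subgroup, which must be [V]; then [N / V] is trivial
    or all of the simple quotient. *)
Lemma unique_minnormal_normals (gT : finGroupType) (G V : {group gT}) :
    unique_minimal_normal G V -> simple (G / V) ->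
  forall N : {group gT}, N <| G -> [\/ N :=: 1, N :=: V | N :=: G].
Proof.
move=> [/andP[sVG minV] uniqV] simL N /andP[sNG nNG].
have /andP[ntV nVG] := mingroupp minV.
have nsVG : V <| G by apply/andP.
have [-> | ntN] := eqsVneq N 1; first exact: Or31.
have [|W minW sWN] := @mingroup_exists _
    (fun M : {group gT} => (M :!=: 1) && (G \subset 'N(M))) N.
  by rewrite ntN.
have sVN : V \subset N.
  by rewrite -(uniqV W) // /minimal_normal (subset_trans sWN).
have nsVN : V <| N by rewrite /normal sVN (subset_trans sNG).
have nsNG : N <| G by apply/andP.
have [_ /(_ _ (quotient_normal V nsNG))[NV1 | NVG]] := simpleP _ simL.
  apply: Or32; apply/eqP; rewrite eqEsubset sVN andbT.
  by rewrite -quotient_sub1 ?normal_norm // NV1.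
by apply: Or33; apply: quotient_inj NVG.
Qed.

Lemma unique_minnormal_perfect (gT : finGroupType) (G V : {group gT}) :
    unique_minimal_normal G V -> simple (G / V) -> ~~ abelian (G / V) ->
  G^`(1) = G.
Proof.
move=> uniqV simL nabL; have nVG : G \subset 'N(V).
  by case: uniqV => /andP[_ /mingroupp/andP[]].
have [G1 | GV | //] := unique_minnormal_normals uniqV simL (der_normal 1 G).
  by rewrite quotient_abelian // in nabL; apply/derG1P.
by rewrite sub_der1_abelian ?GV in nabL.
Qed.

Theorem proposition1 (pi : nat_pred) (pi_prime : forall p : nat, p \in pi -> prime p)
    (gT : finGroupType) (G V : {group gT})
    (uniqV : unique_minimal_normal G V)
    (abelV : abelian V) (ncentV : ~~ (V \subset 'Z(G)))
    (simL : simple (G / V)) (nabL : ~~ abelian (G / V))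
    (H : {group gT}) (submaxH : pi_submaximal pi G H)
    (rT : finGroupType) (Gs : {group rT}) (f : {morphism G >-> rT})
    (embGs : submax_embedding pi H Gs f)
    (minGs : forall (rT' : finGroupType) (Gs' : {group rT'})
               (f' : {morphism G >-> rT'}),
               submax_embedding pi H Gs' f' -> #|Gs| <= #|Gs'|) :
  f @* G <| Gs /\ 'C_Gs(f @* G) = 1.
Proof.
have [[/andP[sVG minV] _] nsubG] := (uniqV, unique_minnormal_normals uniqV simL).
have perfG := unique_minnormal_perfect uniqV simL nabL.
have /andP[ntV nVG] := mingroupp minV.
have [sHG injf snG [K maxK defH]] := embGs.
pose G1 := (f @* G)%G; pose V1 := (f @* V)%G.
have perfG1 : G1^`(1) = G1 by rewrite -morphim_der ?perfG.
have nsVG1 : V1 <| G1 by rewrite morphim_normal //; apply/andP.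
have ntV1 : V1 :!=: 1 by rewrite /= morphim_injm_eq1.
have ncVG1 : ~~ (G1 \subset 'C(V1)).
  apply: contra ncentV => /commG1P; rewrite -morphimR // => /eqP.
  rewrite morphim_injm_eq1 ?(subset_trans (commg_sub _ _)) ?join_subG ?subxx //.
  by move/eqP/commG1P; rewrite centsC subsetI sVG.
have nsubG1 (N : {group rT}) : N <| G1 -> [\/ N :=: 1, N :=: V1 | N :=: G1].
  move=> nsN; have sN : N \subset f @* G := normal_sub nsN.
  have defN : f @* (f @*^-1 N) = N.
    by rewrite morphpreK // (subset_trans sN) ?morphimS.
  have nsPG : f @*^-1 N <| G.
    by have := nsN; rewrite -(morphpre_normal sN (subxx _)) injmK.
  have [N1 | NV | NG] := nsubG _ nsPG; rewrite -defN.
  - by apply: Or31; rewrite N1 morphim1.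
  - by apply: Or32; rewrite NV.
  - by apply: Or33; rewrite NG.
have conjG1 g : g \in Gs -> G1 :^ g = G1 \/ G1 :^ g \subset 'C(G1).
  have abV1 : abelian V1 := morphim_abelian _ abelV.
  exact: conj_eq_or_cent snG perfG1 abV1 nsubG1 ntV1 nsVG1 ncVG1.
(* This intersection is normal in [G1] and centralized by it. Were it [V1] or [G1], then [G1] would
   centralize [V1]. *)
have tiCG : 'C_Gs(G1) :&: G1 = 1.
  have nsI : 'C_Gs(G1) :&: G1 <| G1.
    rewrite /normal subsetIr normsI ?normG // cents_norm //.
    by rewrite centsC subsetIr.
  have cI : G1 \subset 'C('C_Gs(G1) :&: G1) by rewrite centsC subIset ?subsetIr.
  have [// | IV | IG] := nsubG1 _ nsI; first by rewrite IV (negPf ncVG1) in cI.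
  case/negP: ncVG1; apply: subset_trans (centS (normal_sub nsVG1)).
  by rewrite -{2}IG.
have [f1 [_ injf1 snf1 [K1 maxK1 defH1]]] :=
  submax_embedding_aut maxK (subnormal_sub snG) tiCG conjG1.
have sG : G \subset f @*^-1 (f @* G) by rewrite -sub_morphim_pre.
(* The composite has domain [f @*^-1 (f @* G)], so it is restricted to [G] to have the required
   type. *)
pose f2 := restrm_morphism sG (comp_morphism f f1).
have: submax_embedding pi H ('N_Gs(G1) / 'C_Gs(G1)) f2.
  split=> //.
  - by rewrite injm_restrm ?injm_comp.
  - by rewrite morphim_restrm setIid morphim_comp.
  - exists K1; rewrite // !morphim_restrm !morphim_comp setIid (setIidPr sHG).
    by rewrite defH.
move/minGs.
have nsCN : 'C_Gs(G1) <| 'N_Gs(G1) by apply: subcent_normal.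
rewrite card_quotient ?normal_norm //.
have C1 := Lagrange (normal_sub nsCN) => leGs.
have leN : #|'N_Gs(G1)| <= #|Gs| by rewrite subset_leq_card ?subsetIl.
have C_gt0 := cardG_gt0 'C_Gs(G1).
(* Write N and C for the normalizer and centralizer of [G1] in [Gs]. Minimality gives |C| |N : C| =
   |N| <= |Gs| <= |N : C|, which forces |C| = 1 and then N = [Gs]. *)
have C_eq1 : #|'C_Gs(G1)| = 1%N.
  have i_gt0 := indexg_gt0 'N_Gs(G1) 'C_Gs(G1).
  apply/eqP; rewrite eqn_leq C_gt0 andbT -(leq_pmul2r i_gt0) C1 mul1n.
  exact: leq_trans leN leGs.
split; last by apply/eqP; rewrite trivg_card1 C_eq1.
rewrite /normal (subnormal_sub snG) -(setIidPl (_ : Gs \subset 'N(G1))) ?subsetIr //.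
apply/setIidPl/eqP; rewrite eqEcard subsetIl (leq_trans leGs) //.
by rewrite -C1 C_eq1 mul1n.
Qed.
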